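(* (i) There are infinitely many $C_4$-divisible bipartite graphs $G=(A,B)$ (with vertex classes $A$ and $B$) with $|A|=|B|$, $\delta(G)\geq 2|A|/3-2$ and no $C_4$-decomposition. (ii) Let $k\in\mathbb{N}$, $k\geq 2$. There are infinitely many $C_{2k}$-divisible bipartite graphs $G=(A,B)$ with $|A|=|B|$, $\delta(G)\geq |A|/2-1$ and no $C_{2k}$-decomposition.
   Context: Graphs are finite and simple; $e(G)$ is the number of edges and $\delta(G)$ the minimum degree of $G$. $C_\ell$ denotes the cycle of length $\ell$. A graph $G$ is $C_\ell$-divisible if $e(G)$ is divisible by $\ell$ and every vertex of $G$ has even degree. A graph $G$ has a $C_\ell$-decomposition if its edge set can be partitioned into copies of $C_\ell$. *)

(* Defs.v *)
From HB Require Import structures.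
From mathcomp Require Import all_boot all_order all_algebra.

Set Implicit Arguments.
Unset Strict Implicit.
Unset Printing Implicit Defensive.

Record sgraph := SGraph {
  vertex :> finType;
  adj : rel vertex;
  adj_sym : symmetric adj;
  adj_irrefl : irreflexive adj
}.

Definition edge_set (G : sgraph) : {set {set G}} :=
  [set [set p.1; p.2] | p : G * G & adj p.1 p.2].

Definition degree (G : sgraph) (x : G) : nat := #|[set y | adj x y]|.

(* Every degree is at most #|G|, so the neutral element #|G| never affects the
   minimum of a nonempty graph; the empty graph gets the value 0. *)
Definition min_degree (G : sgraph) : nat := \big[minn/#|G|]_(x : G) degree x.

Definition isomorphic (G H : sgraph) : Prop :=
  exists2 f : G -> H, bijective f & forall x y, adj (f x) (f y) = adj x y.

Definition bipartition (G : sgraph) (A B : {set G}) : Prop :=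
  [/\ A :&: B = set0, A :|: B = [set: G] &
      forall x y, adj x y -> (x \in A) && (y \in B) || (x \in B) && (y \in A)].

Definition cycle_adj (l : nat) : rel 'I_l :=
  fun i j => (i != j) && ((j == ordS i) || (i == ordS j)).

Lemma cycle_adj_sym l : symmetric (@cycle_adj l).
Proof. by move=> i j; rewrite /cycle_adj eq_sym orbC. Qed.

Lemma cycle_adj_irrefl l : irreflexive (@cycle_adj l).
Proof. by move=> i; rewrite /cycle_adj eqxx. Qed.

(* This is the cycle of length l when l >= 3; for smaller l it is a
   degenerate graph with at most one edge. *)
Definition cycle_graph (l : nat) : sgraph :=
  SGraph (@cycle_adj_sym l) (@cycle_adj_irrefl l).

(* Copies are given by their edge sets; this loses nothing for a graph H
   without isolated vertices. *)
Definition is_copy (H G : sgraph) (F : {set {set G}}) : Prop :=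
  F \subset edge_set G /\
  exists2 f : H -> G, injective f & F = [set f @: e | e : {set H} in edge_set H].

Definition has_decomposition (H G : sgraph) : Prop :=
  exists2 P : {set {set {set G}}},
    partition P (edge_set G) & forall F, F \in P -> is_copy H F.

Definition cycle_divisible (l : nat) (G : sgraph) : Prop :=
  l %| #|edge_set G| /\ forall x : G, ~~ odd (degree x).

(* Infinitely many graphs up to isomorphism. *)
Definition infinitely_many (P : sgraph -> Prop) : Prop :=
  exists2 G : nat -> sgraph,
    forall n, P (G n) & forall m n, m != n -> ~ isomorphic (G m) (G n).

(* Main.v *)
(**
Both constructions exhibit a set of edges of [G] that meets every copy of the
cycle in a multiple of [d] edges while its own size is not a multiple of [d].

(i) Take the blow-up of [C_6] with classes of odd size [m]: left classes [A_i]
and right classes [B_j] ([i], [j] in {0,1,2}) are completely joined iff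
[i <> j]. Every copy of [C_4] has an even number of edges between [A_0] and
[B_2], but there are [m^2] of them. Deleting a 6-cycle between [A_0] and [B_1]
brings the number of edges to [6 m^2 - 6], a multiple of 4.

(ii) For [k >= 3] take the disjoint union of [K_{N,N}] minus a 4-cycle and
[K_{N-2,N-2}], with [2k | N]: a cycle lies in one component, whereas the second
component has [(N-2)^2 = 4] edges modulo [2k], and the first has [-4]. For
[k = 2] the graphs of (i) already have large enough degree.
*)

Require Import Defs.
From HB Require Import structures.
From mathcomp Require Import all_boot all_order all_algebra.
From mathcomp Require Import zify lra.

Set Implicit Arguments.
Unset Strict Implicit.
Unset Printing Implicit Defensive.

Import Order.TTheory GRing.Theory Num.Theory.

(** * Marked edges and the divisibility obstruction *)

(** Taking any relation lets a set of marked edges be given by a subrelation of adjacency; for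
    [@adj G] it unfolds to [edge_set G]. *)
Definition edges (T : finType) (e : rel T) : {set {set T}} :=
  [set [set p.1; p.2] | p : T * T & e p.1 p.2].

Lemma eq_set2 (T : finType) (a b c d : T) :
  [set a; b] = [set c; d] -> (a = c /\ b = d) \/ (a = d /\ b = c).
Proof.
move=> /setP E; move: (E a) (E b) (E c) (E d); rewrite !inE !eqxx ?orbT /=.
rewrite (eq_sym c a) (eq_sym c b) (eq_sym d a) (eq_sym d b).
by case: (a =P c); case: (a =P d); case: (b =P c); case: (b =P d); auto.
Qed.

Lemma mem_edges (T : finType) (e : rel T) (x y : T) :
  symmetric e -> ([set x; y] \in edges e) = e x y.
Proof.
move=> se; apply/imsetP/idP => [[[u v]] | exy]; last by exists (x, y); rewrite ?inE.
by rewrite inE /= => euv /eq_set2[[-> ->]|[-> ->]] //; rewrite se.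
Qed.

Lemma ordS_neq (l : nat) (i : 'I_l) : 1 < l -> i != ordS i.
Proof.
case: i => i il l1; rewrite -val_eqE /=.
have [il'|?] := ltnP i.+1 l; first by rewrite modn_small; lia.
have <- : i.+1 = l by lia.
by rewrite modnn; lia.
Qed.

Lemma ordS2_neq (l : nat) (i : 'I_l) : 2 < l -> i != ordS (ordS i).
Proof.
case: i => i il l1; rewrite -val_eqE /=.
have [il'|?] := ltnP i.+1 l; last first.
  have <- : i.+1 = l by lia.
  by rewrite modnn modn_small; lia.
rewrite (modn_small il'); have [il''|?] := ltnP i.+2 l.
  by rewrite modn_small; lia.
have <- : i.+2 = l by lia.
by rewrite modnn; lia.
Qed.

Lemma edge_set_cycle (l : nat) : 1 < l ->
  edge_set (cycle_graph l) = [set [set i; ordS i] | i : 'I_l].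
Proof.
move=> l1; apply/setP => s; apply/imsetP/imsetP => [[[i j]]|[i _ ->]].
  rewrite inE /= => /andP[_ /orP[]/eqP-> ->]; first by exists i.
  by exists j; rewrite // setUC.
by exists (i, ordS i); rewrite // inE /= /cycle_adj ordS_neq //= eqxx.
Qed.

(** For [l > 2], distinct indices [i] give distinct edges [{f i, f (i+1)}], so marked edges of a
    copy are counted by their starting index. *)
Lemma card_copy_edges (l : nat) (G : sgraph) (e : rel G) (f : 'I_l -> G) :
    2 < l -> symmetric e -> injective f ->
  #|[set f @: s | s : {set 'I_l} in edge_set (cycle_graph l)] :&: edges e| =
  #|[set i | e (f i) (f (ordS i))]|.
Proof.
move=> l2 se fI; rewrite (edge_set_cycle (ltnW l2)).
set g := fun i => [set f i; f (ordS i)].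
have gI : injective g.
  move=> i j /eq_set2[[/fI]|[/fI-> /fI/esym/eqP]] //.
  by rewrite (negPf (ordS2_neq _ l2)).
rewrite -(card_imset _ gI); apply: eq_card => s; rewrite inE.
apply/andP/imsetP => [[/imsetP[t /imsetP[i _ ->] ->]]|[i]].
  by rewrite imsetU1 imset_set1 mem_edges // => ei; exists i; rewrite ?inE.
rewrite inE => ei ->; rewrite mem_edges //; split=> //.
apply/imsetP; exists [set i; ordS i]; first exact: imset_f.
by rewrite imsetU1 imset_set1.
Qed.

(** The parts of a decomposition split the marked edges into disjoint sets of size divisible by [d].
    The hypothesis speaks of all closed walks of length [l], injective or not. *)
Lemma decomposition_dvd (d l : nat) (G : sgraph) (e : rel G) :
    2 < l -> symmetric e -> subrel e (@adj G) ->
    (forall f : 'I_l -> G, (forall i, adj (f i) (f (ordS i))) ->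
       d %| #|[set i | e (f i) (f (ordS i))]|) ->
  has_decomposition (cycle_graph l) G -> d %| #|edges e|.
Proof.
move=> l2 se sub dP [P partP copyP].
have /and3P[/eqP covP tiP _] := partP.
have sE : edges e \subset cover P.
  rewrite covP; apply/subsetP => s /imsetP[p]; rewrite inE => /sub ap ->.
  by apply/imsetP; exists p; rewrite ?inE.
have -> : #|edges e| = \sum_(F in P) #|F :&: edges e|.
  rewrite -{1}(setIidPr sE) -sum1_card; under eq_bigl do rewrite inE.
  rewrite big_trivIset_cond //; apply: eq_bigr => F _.
  by rewrite -sum1_card; apply: eq_bigl => s; rewrite inE.
apply: dvdn_sum => F /copyP[FE [f fI FD]].
rewrite FD card_copy_edges //; apply: dP => i.
have : [set f i; f (ordS i)] \in edges (@adj G).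
  apply: (subsetP FE); rewrite FD; apply/imsetP; exists [set i; ordS i].
    by rewrite (edge_set_cycle (ltnW l2)); apply: imset_f.
  by rewrite imsetU1 imset_set1.
by rewrite mem_edges //; apply: adj_sym.
Qed.


(** * Minimum degree and infinite families *)

(** The first hypothesis covers the neutral element [#|G|] of the minimum. *)
Lemma min_degree_ge (G : sgraph) (d : nat) :
  d <= #|G| -> (forall x : G, d <= degree x) -> d <= min_degree G.
Proof.
move=> dG dx; apply: (big_ind (leq d)) => // a b da db.
by rewrite leq_min da.
Qed.

Lemma infinitely_many_card (P : sgraph -> Prop) (G : nat -> sgraph) :
  (forall n, P (G n)) -> injective (fun n => #|G n|) -> infinitely_many P.
Proof.
move=> PG GI; exists G => // m n /eqP mn [f fB _]; apply/mn/GI.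
exact: bij_eq_card fB.
Qed.

Lemma card_ltn_ord (m p : nat) : p <= m -> #|[set i : 'I_m | i < p]| = p.
Proof.
by move=> pm; rewrite -sum1dep_card -(big_ord_widen _ (fun=> 1)) // sum1_card card_ord.
Qed.

(** * Bipartite graphs from a relation between two types *)

Section BipartiteGraph.

Variables X Y : finType.
Implicit Type r : X -> Y -> bool.

Definition birel r : rel (X + Y) := fun u v =>
  match u, v with
  | inl x, inr y | inr y, inl x => r x y
  | _, _ => false
  end.

Lemma birel_sym r : symmetric (birel r). Proof. by case=> ? []. Qed.

Lemma birel_irrefl r : irreflexive (birel r). Proof. by case. Qed.

Definition bigraph r : sgraph := SGraph (@birel_sym r) (@birel_irrefl r).

Lemma card_edges_birel r : #|edges (birel r)| = #|[set p | r p.1 p.2]|.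
Proof.
set g := fun p : X * Y => [set inl p.1; inr p.2] : {set X + Y}.
have gI : injective g by move=> [x y] [x' y'] /eq_set2[][] // [->] [->].
rewrite -(card_imset _ gI); apply: eq_card => s.
apply/imsetP/imsetP => [[[[x|y] [x'|y']]]|[[x y]]]; rewrite inE //= => e ->.
- by exists (x, y'); rewrite ?inE.
- by exists (x', y); rewrite ?inE // setUC.
by exists (inl x, inr y); rewrite ?inE.
Qed.

Lemma degree_inl r (x : X) : @degree (bigraph r) (inl x) = #|[set y | r x y]|.
Proof.
rewrite -(card_imset _ (@inr_inj X Y)); apply: eq_card => u; rewrite inE.
apply/idP/imsetP => [|[y] /[!inE] rxy -> //].
by case: u => // y rxy; exists y; rewrite ?inE.
Qed.

Lemma degree_inr r (y : Y) : @degree (bigraph r) (inr y) = #|[set x | r x y]|.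
Proof.
rewrite -(card_imset _ (@inl_inj X Y)); apply: eq_card => u; rewrite inE.
apply/idP/imsetP => [|[x] /[!inE] rxy -> //].
by case: u => // x rxy; exists x; rewrite ?inE.
Qed.

Lemma card_edges_degrees r :
  #|edge_set (bigraph r)| = \sum_x #|[set y | r x y]|.
Proof.
rewrite [LHS]card_edges_birel -sum1dep_card.
rewrite -(pair_big_dep xpredT r (fun _ _ => 1)) /=.
by apply: eq_bigr => x _; rewrite sum1dep_card.
Qed.

Lemma bigraph_bipartition r :
  @bipartition (bigraph r) [set inl x | x : X] [set inr y | y : Y].
Proof.
have inlA (x : X) : (inl x : X + Y) \in [set inl x | x : X] by exact: imset_f.
have inrB (y : Y) : (inr y : X + Y) \in [set inr y | y : Y] by exact: imset_f.
split.
- by apply/setP => u; rewrite !inE; apply/andP=> -[/imsetP[x _ ->] /imsetP[]].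
- by apply/setP => -[x|y]; rewrite !inE ?inlA ?inrB ?orbT.
by case=> [x|y] [x'|y'] //= _; rewrite ?inlA ?inrB ?orbT.
Qed.

End BipartiteGraph.

(** * Part (i): the blow-up of the 6-cycle *)

(* The 6-cycle K_{3,3} minus a perfect matching, on the first three vertices of
   the p-th class on the left and of the q-th class on the right. *)
Definition hexagon (m : nat) (p q : 'I_3) (x y : 'I_3 * 'I_m) : bool :=
  [&& x.1 == p, y.1 == q, x.2 < 3, y.2 < 3 & x.2 != y.2].

Definition blowup (m : nat) (p q : 'I_3) (x y : 'I_3 * 'I_m) : bool :=
  (x.1 != y.1) && ~~ hexagon p q x y.

(** Exchanging the two sides exchanges [p] and [q]; with both kept as parameters, degrees on the
    right follow from those on the left. *)
Lemma blowup_swap (m : nat) (p q : 'I_3) (x y : 'I_3 * 'I_m) :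
  blowup p q x y = blowup q p y x.
Proof.
rewrite /blowup /hexagon (eq_sym x.1 y.1) (eq_sym x.2 y.2).
by do 4!case: (_ == _); case: (x.2 < 3); case: (y.2 < 3).
Qed.

(** A vertex sees two full classes and loses two neighbours if it lies on the hexagon; [p != q]
    ensures that the hexagon consists of edges of the blow-up. The additive form avoids truncated
    subtraction. *)
Lemma card_blowup_row (m : nat) (p q : 'I_3) (x : 'I_3 * 'I_m) :
    p != q -> 2 < m ->
  #|[set y | blowup p q x y]| + 2 * ((x.1 == p) && (x.2 < 3)) = 2 * m.
Proof.
move=> pq m2.
have cA : #|[set y : 'I_3 * 'I_m | x.1 != y.1]| = 2 * m.
  have -> : [set y : 'I_3 * 'I_m | x.1 != y.1] = setX [set~ x.1] [set: 'I_m].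
    by apply/setP => y; rewrite !inE andbT eq_sym.
  by rewrite cardsX cardsC1 cardsT !card_ord.
have <- : #|[set y | hexagon p q x y]| = 2 * ((x.1 == p) && (x.2 < 3)).
  case: andP => [[xp x3]|nx]; last first.
    apply: eq_card0 => y; rewrite inE /hexagon.
    by apply/negbTE/negP => /and5P[xp _ x3 _ _]; case: nx.
  have -> : [set y | hexagon p q x y] =
      setX [set q] ([set j : 'I_m | j < 3] :\ x.2).
    apply/setP => y; rewrite !inE /hexagon xp x3 /= (eq_sym y.2).
    by rewrite (andbC (_ < 3)).
  rewrite cardsX cards1; have := cardsD1 x.2 [set j : 'I_m | j < 3].
  by rewrite card_ltn_ord // inE x3; lia.
rewrite -cA -(cardsID [set y | hexagon p q x y] [set y | x.1 != y.1]) addnC.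
congr (_ + _); last by apply: eq_card => y; rewrite !inE andbC.
apply: eq_card => y; rewrite !inE; apply/idP/andP => [h|[]//]; split=> //.
by case/and5P: h => /eqP-> /eqP->.
Qed.

Lemma card_blowup_col (m : nat) (p q : 'I_3) (y : 'I_3 * 'I_m) :
    p != q -> 2 < m ->
  #|[set x | blowup p q x y]| + 2 * ((y.1 == q) && (y.2 < 3)) = 2 * m.
Proof.
move=> pq m2; rewrite -(@card_blowup_row m q p y) 1?eq_sym //; congr (_ + _).
by apply: eq_card => x; rewrite !inE blowup_swap.
Qed.

Lemma card_blowup_edges (m : nat) (p q : 'I_3) : p != q -> 2 < m ->
  #|edge_set (bigraph (@blowup m p q))| + 6 = 6 * m ^ 2.
Proof.
move=> pq m2; rewrite card_edges_degrees.
have hex : \sum_(x : 'I_3 * 'I_m) 2 * ((x.1 == p) && (x.2 < 3)) = 6.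
  rewrite -big_distrr /= -big_mkcond sum1dep_card.
  have -> : [set x : 'I_3 * 'I_m | (x.1 == p) && (x.2 < 3)] =
      setX [set p] [set j : 'I_m | j < 3] by apply/setP => x; rewrite !inE.
  by rewrite cardsX cards1 card_ltn_ord.
rewrite -[X in _ + X]hex -big_split /=.
rewrite (eq_bigr (fun=> 2 * m)) => [|x _]; last exact: card_blowup_row.
by rewrite sum_nat_const card_prod !card_ord -mulnn; nia.
Qed.

Definition blowup02 (m : nat) (x y : 'I_3 * 'I_m) : bool :=
  (x.1 == 0 :> nat) && (y.1 == 2 :> nat).

Lemma card_blowup02 (m : nat) : #|edges (birel (@blowup02 m))| = m ^ 2.
Proof.
rewrite card_edges_birel.
have -> : [set p : ('I_3 * 'I_m) * ('I_3 * 'I_m) | blowup02 p.1 p.2] =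
    setX (setX [set ord0] setT) (setX [set ord_max] setT).
  by apply/setP => p; rewrite !inE !andbT -!val_eqE.
by rewrite !cardsX !cards1 cardsT card_ord -mulnn; nia.
Qed.

(* The classes are the vertices of a 6-cycle and the walk projects to a closed
   4-walk on it, which has winding number 0, so crosses each edge evenly. *)
Lemma blowup02_walk (m : nat) (p q : 'I_3) (u v w z : bigraph (@blowup m p q)) :
    adj u v -> adj v w -> adj w z -> adj z u ->
  ~~ odd (birel (@blowup02 m) u v + (birel (@blowup02 m) v w +
         (birel (@blowup02 m) w z + birel (@blowup02 m) z u))).
Proof.
(* Forgetting the hexagon and the positions inside the classes leaves a finite check on four class
   indices. *)
case: u v w z => [[a i]|[a i]] [[b j]|[b j]] [[c k]|[c k]] [[d l]|[d l]] //=;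
  rewrite /blowup /blowup02 /= => /andP[+ _] /andP[+ _] /andP[+ _] /andP[+ _];
  move: a b c d => [[|[|[|//]]] ?] [[|[|[|//]]] ?] [[|[|[|//]]] ?] [[|[|[|//]]] ?];
  by rewrite -!val_eqE.
Qed.

Lemma blowup02_cycle (m : nat) (p q : 'I_3) (f : 'I_4 -> bigraph (@blowup m p q)) :
  (forall i, adj (f i) (f (ordS i))) ->
  2 %| #|[set i | birel (@blowup02 m) (f i) (f (ordS i))]|.
Proof.
move=> fC; rewrite dvdn2 -sum1dep_card big_mkcond /= !big_ord_recl big_ord0 addn0.
(* The four indices become iterates of [ordS], so that the sum reads as a closed walk. *)
have -> : lift ord0 (lift ord0 (lift ord0 ord0)) = iter 3 (@ordS 4) ord0 by apply: val_inj.
have -> : lift ord0 (lift ord0 ord0) = iter 2 (@ordS 4) ord0 by apply: val_inj.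
have -> : lift ord0 ord0 = ordS (ord0 : 'I_4) by apply: val_inj.
have walk_closed : ordS (iter 3 (@ordS 4) ord0) = ord0 by apply: val_inj.
have := fC (iter 3 (@ordS 4) ord0); rewrite walk_closed.
exact: blowup02_walk.
Qed.

Lemma blowup_example (m : nat) (G := bigraph (@blowup m ord0 (lift ord0 ord0))) :
    odd m -> 2 < m ->
  exists A B : {set G},
    [/\ bipartition A B, #|A| = #|B|, cycle_divisible 4 G,
        #|A| = 3 * m /\ 2 * m - 2 <= min_degree G &
        ~ has_decomposition (cycle_graph 4) G].
Proof.
move=> odd_m m2; set q : 'I_3 := lift ord0 ord0 in G *; have q0 : ord0 != q by [].
exists [set inl x | x : 'I_3 * 'I_m], [set inr y | y : 'I_3 * 'I_m].
have cA : #|[set (inl x : G) | x : 'I_3 * 'I_m]| = 3 * m.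
  by rewrite card_imset ?card_prod ?card_ord //; exact: inl_inj.
have cB : #|[set (inr x : G) | x : 'I_3 * 'I_m]| = 3 * m.
  by rewrite card_imset ?card_prod ?card_ord //; exact: inr_inj.
(* Thus the graph has [6 * m ^ 2 - 6 = 24 * t] edges, while the number [m ^ 2] of marked edges is
   odd. *)
have [t m_sq] : exists t, m ^ 2 = 4 * t + 1.
  have [h ->] : exists h, m = 2 * h + 1 by exists m./2; lia.
  by exists (h * h.+1); rewrite -mulnn; nia.
split.
- exact: bigraph_bipartition.
- by rewrite cA cB.
- split; first by have := card_blowup_edges q0 m2; rewrite m_sq -/G => e6; apply/dvdnP; exists (6 * t); lia.
  case=> x; rewrite ?degree_inl ?degree_inr.
    by have := card_blowup_row x q0 m2; case: (_ && _); lia.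
  by have := card_blowup_col x q0 m2; case: (_ && _); lia.
- split=> //; apply: min_degree_ge.
    by rewrite card_sum !card_prod !card_ord; lia.
  case=> x; rewrite ?degree_inl ?degree_inr.
    by have := card_blowup_row x q0 m2; case: (_ && _); lia.
  by have := card_blowup_col x q0 m2; case: (_ && _); lia.
move=> dec; have : 2 %| #|edges (birel (@blowup02 m))|.
  apply: (decomposition_dvd _ _ _ _ dec) => //.
  - exact: birel_sym.
  (* The hexagon ends in right class 1, so no edge into right class 2 was deleted. *)
  - case=> [x|x] [y|y] //=; rewrite /blowup02 /blowup /hexagon -!val_eqE /=;
    by case/andP => /eqP-> /eqP->.
  exact: blowup02_cycle.
by rewrite card_blowup02 m_sq; lia.
Qed.

(** * Part (ii): two disjoint blocks *)

Lemma ordS_invariant (T : Type) (l : nat) (g : 'I_l -> T) :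
  (forall i, g (ordS i) = g i) -> forall i j, g i = g j.
Proof.
move=> gS i; have l0 : 0 < l by case: i => i; lia.
suff g0 k (kl : k < l) : g (Ordinal kl) = g (Ordinal l0).
  by case: i => i il [j jl]; rewrite !g0.
elim: k kl => [|k IHk] kl; first by congr g; apply: val_inj.
rewrite -(IHk (ltnW kl)) -[RHS]gS; congr g; apply: val_inj => /=.
by rewrite modn_small.
Qed.

(** The deleted 4-cycle is the [K_{2,2}] on the first two vertices of each side of the first
    block. *)
Definition two_blocks (N M : nat) (x y : 'I_N + 'I_M) : bool :=
  match x, y with
  | inl i, inl j => ~~ ((i < 2) && (j < 2))
  | inr _, inr _ => true
  | _, _ => false
  end.

Definition second_block (N M : nat) (x y : 'I_N + 'I_M) : bool :=
  match x, y with inr _, inr _ => true | _, _ => false end.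

Definition in_second_block (N M : nat) (u : ('I_N + 'I_M) + ('I_N + 'I_M)) : bool :=
  match u with inl (inr _) | inr (inr _) => true | _ => false end.

Lemma two_blocks_sym (N M : nat) (x y : 'I_N + 'I_M) :
  two_blocks x y = two_blocks y x.
Proof. by case: x y => x [] y //=; rewrite andbC. Qed.

Lemma card_two_blocks_row (N M : nat) (x : 'I_N + 'I_M) : 1 < N ->
  #|[set y | two_blocks x y]| + (if x is inl i then 2 * (i < 2) else 0) =
    if x is inl _ then N else M.
Proof.
move=> N1; rewrite -sum1dep_card big_sumType /=.
case: x => i /=; last by rewrite big_pred0_eq sum1_card card_ord addn0.
rewrite big_pred0_eq addn0 sum1dep_card.
case: (i < 2) => /=; last by rewrite cardsT card_ord addn0.
have := cardsC [set j : 'I_N | j < 2]; rewrite card_ltn_ord // card_ord addnC => cE; rewrite -[RHS]cE.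
by congr (_ + _); apply: eq_card => j; rewrite !inE.
Qed.

Lemma card_two_blocks_edges (N M : nat) : 1 < N ->
  #|edge_set (bigraph (@two_blocks N M))| + 4 = N ^ 2 + M ^ 2.
Proof.
move=> N1; rewrite card_edges_degrees.
have four : \sum_(x : 'I_N + 'I_M) (if x is inl i then 2 * (i < 2) else 0) = 4.
  rewrite big_sumType /= [X in _ + X]big1_eq addn0 -big_distrr /= -big_mkcond.
  by rewrite sum1dep_card card_ltn_ord.
rewrite -[X in _ + X]four -big_split /=.
rewrite (eq_bigr _ (fun x _ => card_two_blocks_row x N1)) big_sumType /=.
by rewrite !sum_nat_const !card_ord !mulnn.
Qed.

Lemma card_second_block (N M : nat) :
  #|edges (birel (@second_block N M))| = M ^ 2.
Proof.
rewrite card_edges_birel -sum1dep_card.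
rewrite -(pair_big_dep xpredT (@second_block N M) (fun _ _ => 1)) /= big_sumType /=.
rewrite [X in X + _]big1 => [|i _]; last by rewrite big_pred0_eq.
rewrite add0n (eq_bigr (fun=> M)) => [|i _].
  by rewrite sum_nat_const card_ord mulnn.
by rewrite big_sumType /= big_pred0_eq sum1_card card_ord.
Qed.

(** Adjacent vertices share a block, so a closed walk has either all [l] steps in the second block
    or none. *)
Lemma second_block_cycle (N M l : nat) (f : 'I_l -> bigraph (@two_blocks N M)) :
  (forall i, adj (f i) (f (ordS i))) ->
  l %| #|[set i | birel (@second_block N M) (f i) (f (ordS i))]|.
Proof.
move=> fC.
have stepE u v : birel (@two_blocks N M) u v ->
    in_second_block v = in_second_block u /\
    birel (@second_block N M) u v = in_second_block u.
  by case: u v => [[i|i]|[i|i]] [[j|j]|[j|j]].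
have gE := ordS_invariant (fun i => (stepE _ _ (fC i)).1).
have -> : [set i | birel (@second_block N M) (f i) (f (ordS i))] =
    [set i | in_second_block (f i)].
  by apply/setP => i; rewrite !inE (stepE _ _ (fC i)).2.
have [i Pi|no] := pickP (fun i => in_second_block (f i)).
  rewrite (_ : [set _ | _] = setT) ?cardsT ?card_ord //.
  by apply/setP => j; rewrite !inE (gE j i).
by rewrite eq_card0 // => j; rewrite inE no.
Qed.

(** The ends of the deleted edges have degree [N - 2], as do all vertices of the second block; this
    equals [|A| / 2 - 1] for [|A| = 2 * N - 2]. *)
Lemma two_blocks_example (k n : nat) (N := 2 * k * n.+1)
    (G := bigraph (@two_blocks N (N - 2))) :
    2 < k ->
  exists A B : {set G},
    [/\ bipartition A B, #|A| = #|B|, cycle_divisible (2 * k) G,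
        #|A| = 2 * N - 2 /\ N - 2 <= min_degree G &
        ~ has_decomposition (cycle_graph (2 * k)) G].
Proof.
move=> k2; have N6 : 6 <= N by rewrite /N; nia.
pose X := ('I_N + 'I_(N - 2))%type.
exists [set inl x | x : X], [set inr y | y : X].
have cA : #|[set (inl x : G) | x : X]| = 2 * N - 2.
  by rewrite card_imset ?card_sum ?card_ord; [lia | exact: inl_inj].
have cB : #|[set (inr x : G) | x : X]| = 2 * N - 2.
  by rewrite card_imset ?card_sum ?card_ord; [lia | exact: inr_inj].
have N1 : 1 < N by lia.
have degE (u : G) : exists2 x : X, degree u = #|[set y | two_blocks x y]| &
    #|[set y | two_blocks x y]| + (if x is inl i then 2 * (i < 2) else 0) =
    if x is inl _ then N else N - 2.
  case: u => x; exists x; rewrite ?card_two_blocks_row ?degree_inl ?degree_inr //.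
  by apply: eq_card => y; rewrite !inE two_blocks_sym.
have odd_N : ~~ odd N by rewrite /N -mulnA oddM.
have M_sq : exists q, (N - 2) ^ 2 = 2 * k * q + 4.
  (* From [(N - 2) ^ 2 = N * (N - 4) + 4] and [N = 2 * k * n.+1]. *)
  exists (N * n.+1 - 4 * n.+1); rewrite -mulnn; move: N6; rewrite /N; nia.
split.
- exact: bigraph_bipartition.
- by rewrite cA cB.
- split.
    have := card_two_blocks_edges (N - 2) N1; rewrite -/G.
    case: M_sq => q -> eE; apply/dvdnP; exists (N * n.+1 + q).
    by move: eE; rewrite -mulnn {1}/N; nia.
  move=> u; have [[i|i] -> ] := degE u; last by rewrite addn0 => ->; lia.
  by case: (_ < 2); lia.
- split=> //; apply: min_degree_ge; first by rewrite card_sum !card_sum !card_ord; lia.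
  move=> u; have [[i|i] ->] := degE u; last by lia.
  by case: (_ < 2); lia.
move=> dec; have : 2 * k %| #|edges (birel (@second_block N (N - 2)))|.
  apply: (decomposition_dvd _ _ _ _ dec); first by lia.
  - exact: birel_sym.
  - by case=> [[i|i]|[i|i]] [[j|j]|[j|j]].
  exact: second_block_cycle.
rewrite card_second_block; case: M_sq => q ->.
(* Otherwise [2 * k] would divide 4, which [k > 2] excludes. *)
by rewrite (dvdn_addr 4 (dvdn_mulr q (dvdnn _))) => /dvdn_leq; lia.
Qed.

(** * The two infinite families and their rational degree bounds *)

Local Open Scope ring_scope.

Theorem proposition1p5 :
  infinitely_many (fun G : sgraph =>
    exists A B : {set G},
      [/\ bipartition A B,
          #|A| = #|B|,
          cycle_divisible 4 G,
          2 * #|A|%:R / 3 - 2 <= (min_degree G)%:R :> rat &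
          ~ has_decomposition (cycle_graph 4) G])
  /\
  (forall k : nat, (2 <= k)%N ->
    infinitely_many (fun G : sgraph =>
      exists A B : {set G},
        [/\ bipartition A B,
            #|A| = #|B|,
            cycle_divisible (2 * k) G,
            #|A|%:R / 2 - 1 <= (min_degree G)%:R :> rat &
            ~ has_decomposition (cycle_graph (2 * k)) G])).
Proof.
(* Class sizes [2 * n + 3] run through the odd numbers from 3 on. *)
pose Gi n := bigraph (@blowup (2 * n + 3) ord0 (lift ord0 ord0)).
have ex n := @blowup_example (2 * n + 3).
have GiI : injective (fun n => #|Gi n|).
  by move=> m n; rewrite /= !card_sum !card_prod !card_ord; lia.
split.
  apply: infinitely_many_card GiI => n.
  have [||A [B [? ? ? [cA dG] ?]]] := ex n; try lia.
  exists A, B; split=> //.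
  (* With denominators cleared, the bound is an inequality of natural numbers. *)
  have : 2 * #|A|%:R <= 3 * ((min_degree (Gi n))%:R + 2) :> rat.
    by rewrite -!natrM -natrD -natrM ler_nat cA; move: dG; rewrite -/(Gi n); lia.
  by lra.
move=> k; case: (ltngtP 2 k) => // [k2|<-] _.
  pose G n := bigraph (@two_blocks (2 * k * n.+1) (2 * k * n.+1 - 2)).
  apply: (@infinitely_many_card _ G) => [n|m n]; last first.
    rewrite /= !card_sum !card_ord => cE.
    have N2 i : (2 <= 2 * k * i.+1)%N by nia.
    have /eqP : (2 * k * m.+1 = 2 * k * n.+1)%N by have := (N2 m, N2 n); lia.
    by rewrite eqn_pmul2l; [move=> /eqP[] | lia].
  have [A [B [? ? ? [cA dG] ?]]] := two_blocks_example n k2.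
  exists A, B; split=> //.
  have : #|A|%:R <= 2 * ((min_degree (G n))%:R + 1) :> rat.
    by rewrite natr1 -natrM ler_nat cA; move: dG; rewrite -/(G n); lia.
  by lra.
(* Case [k = 2]: with class size [m >= 3], the degree bound [2 * m - 2] exceeds [3 * m / 2 - 1]. *)
apply: infinitely_many_card GiI => n.
have [||A [B [? ? ? [cA dG] ?]]] := ex n; try lia.
exists A, B; split=> //.
have : #|A|%:R <= 2 * ((min_degree (Gi n))%:R + 1) :> rat.
  by rewrite natr1 -natrM ler_nat cA; move: dG; rewrite -/(Gi n); lia.
by lra.
Qed.
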